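(* (i) For every $\phi\in\mathcal{L}_{\mathtt{CL}}$: $\phi$ is valid in every intuitionistic Kripke frame under team semantics if and only if $\mathcal{A}\vDash^c\phi$ for every inquisitive algebra $\mathcal{A}$. (ii) For every $\phi\in\mathcal{L}_{\mathtt{CL}}^{\otimes}$: $\phi$ is valid in every intuitionistic Kripke frame under team semantics if and only if $\mathcal{A}\vDash^c\phi$ for every well-connected dependence algebra $\mathcal{A}$.
   Context: Formulas: $\mathcal{L}_{\mathtt{CL}}$ is generated from a countable set $\mathtt{At}$ of variables by $\bot,\land,\lor,\to$; $\mathcal{L}_{\mathtt{CL}}^{\otimes}$ also allows $\otimes$. Team semantics: an intuitionistic Kripke frame is a poset $(W,R)$; a model adds $V:W\to\wp(\mathtt{At})$ with $p\in V(w)$, $wRv$ implying $p\in V(v)$. For $t\subseteq W$: $t\vDash p$ iff $p\in V(w)$ for all $w\in t$; $t\vDash\bot$ iff $t=\varnothing$; $t\vDash\psi\lor\chi$ iff $t\vDash\psi$ or $t\vDash\chi$; $t\vDash\psi\land\chi$ iff both; $t\vDash\psi\otimes\chi$ iff there are $s,r\subseteq t$ with $s\cup r=t$, $s\vDash\psi$, $r\vDash\chi$; $t\vDash\psi\to\chi$ iff for all $s\subseteq R[t]$, $s\vDash\psi$ implies $s\vDash\chi$. $\phi$ is valid in a frame if $t\vDash\phi$ for every valuation $V$ and every $t\subseteq W$. A Brouwerian semilattice is $(B,\land,\to,0)$ with $(B,\land)$ a meet-semilattice with least element $0$ and $a\land b\le c\iff a\le b\to c$. An inquisitive algebra is a first-order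 structure $\mathcal{A}=(A,A_c,\land,\lor,\to,0)$ with a unary predicate $A_c\subseteq A$ (the core) such that, with $\langle A_c\rangle$ the closure of $A_c$ under $\land,\lor,\to,0$, $(\langle A_c\rangle,\lor,\land,\to,0)$ is a Heyting algebra; $(A_c,\land,\to,0)$ is a Brouwerian semilattice; and $a\to(x\lor y)=(a\to x)\lor(a\to y)$ for all $a\in A_c$, $x,y\in\langle A_c\rangle$. A dependence algebra is $(A,A_c,\land,\otimes,\lor,\to,0)$ with $A_c\subseteq A$ such that, with $\langle A_c\rangle$ the closure under $\lor,\otimes,\land,\to,0$, $(\langle A_c\rangle,\lor,\land,\to,0)$ is a Heyting algebra; $(A_c,\otimes,\land,\to,0)$ is a Heyting algebra; and for $a\in A_c$, $x,y,z,k\in\langle A_c\rangle$: $a\to(x\lor y)=(a\to x)\lor(a\to y)$, $x\otimes(y\lor z)=(x\otimes y)\lor(x\otimes z)$, $(x\to z)\to(y\to k)=(x\otimes y)\to(z\otimes k)$. It is well-connected if in $\langle A_c\rangle$, $x\lor y=1$ implies $x=1$ or $y=1$ ($1:=0\to0$). A core valuation is $\mu:\mathtt{At}\to A_c$, extended homomorphically to formulas; $\mathcal{A}\vDash^c\phi$ means $\phi$ evaluates to $1$ under every core valuation.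
   Formalization: In (ii) the third law of dependence algebras, which as printed forces 0 = 1, is replaced by monotonicity of ⊗: (x→z)→((y→k)→((x⊗y)→(z⊗k))) = 1; and commutativity of ⊗ on ⟨A_c⟩, without which (ii) fails, is added. *)

(* Defs.v *)
From mathcomp Require Import all_boot.
From mathcomp Require Import boolp classical_sets.

Set Implicit Arguments.
Unset Strict Implicit.
Unset Printing Implicit Defensive.

Local Open Scope classical_set_scope.

Inductive cl_formula (At : Type) : Type :=
| cl_var of At
| cl_bot
| cl_and of cl_formula At & cl_formula At
| cl_or of cl_formula At & cl_formula At
| cl_imp of cl_formula At & cl_formula At.

Arguments cl_bot {At}.

Inductive clt_formula (At : Type) : Type :=
| clt_var of At
| clt_bot
| clt_and of clt_formula At & clt_formula At
| clt_or of clt_formula At & clt_formula At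
| clt_imp of clt_formula At & clt_formula At
| clt_tensor of clt_formula At & clt_formula At.

Arguments clt_bot {At}.

Record kripke_frame := KripkeFrame {
  world :> Type;
  acc : world -> world -> Prop;
  acc_refl : forall w, acc w w;
  acc_trans : forall u v w, acc u v -> acc v w -> acc u w;
  acc_antisym : forall v w, acc v w -> acc w v -> v = w
}.

Definition persistent (At : Type) (F : kripke_frame) (V : F -> set At) : Prop :=
  forall (p : At) (w v : F), V w p -> acc w v -> V v p.

(* R[t] *)
Definition acc_image (F : kripke_frame) (t : set F) : set F :=
  [set v | exists2 w, t w & acc w v].

Fixpoint cl_support (At : Type) (F : kripke_frame) (V : F -> set At)
    (t : set F) (phi : cl_formula At) : Prop :=
  match phi with
  | cl_var p => forall w, t w -> V w p
  | cl_bot => t = set0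
  | cl_and psi chi => cl_support V t psi /\ cl_support V t chi
  | cl_or psi chi => cl_support V t psi \/ cl_support V t chi
  | cl_imp psi chi => forall s : set F, s `<=` acc_image t ->
      cl_support V s psi -> cl_support V s chi
  end.

Fixpoint clt_support (At : Type) (F : kripke_frame) (V : F -> set At)
    (t : set F) (phi : clt_formula At) : Prop :=
  match phi with
  | clt_var p => forall w, t w -> V w p
  | clt_bot => t = set0
  | clt_and psi chi => clt_support V t psi /\ clt_support V t chi
  | clt_or psi chi => clt_support V t psi \/ clt_support V t chi
  | clt_imp psi chi => forall s : set F, s `<=` acc_image t ->
      clt_support V s psi -> clt_support V s chi
  | clt_tensor psi chi => exists s r : set F,
      [/\ s `<=` t, r `<=` t, s `|` r = t,
          clt_support V s psi & clt_support V r chi]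
  end.

Definition cl_frame_valid (At : Type) (F : kripke_frame)
    (phi : cl_formula At) : Prop :=
  forall V : F -> set At, persistent V -> forall t : set F, cl_support V t phi.

Definition clt_frame_valid (At : Type) (F : kripke_frame)
    (phi : clt_formula At) : Prop :=
  forall V : F -> set At, persistent V -> forall t : set F, clt_support V t phi.

(* [brouwerian_on S meet imp bot]: the subset S of T, with the restrictions of
   the given operations, is a Brouwerian semilattice; the order x <= y is
   meet x y = x. *)
Record brouwerian_on (T : Type) (S : set T) (meet imp : T -> T -> T)
    (bot : T) : Prop := {
  brw_bot : S bot;
  brw_meet : forall x y, S x -> S y -> S (meet x y);
  brw_imp : forall x y, S x -> S y -> S (imp x y);
  brw_meetA : forall x y z, S x -> S y -> S z ->
    meet x (meet y z) = meet (meet x y) z;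
  brw_meetC : forall x y, S x -> S y -> meet x y = meet y x;
  brw_meetxx : forall x, S x -> meet x x = x;
  brw_le0x : forall x, S x -> meet bot x = bot;
  brw_residuation : forall a b c, S a -> S b -> S c ->
    (meet (meet a b) c = meet a b <-> meet a (imp b c) = a)
}.

Record heyting_on (T : Type) (S : set T) (join meet imp : T -> T -> T)
    (bot : T) : Prop := {
  hey_brouwerian : brouwerian_on S meet imp bot;
  hey_join : forall x y, S x -> S y -> S (join x y);
  hey_joinA : forall x y z, S x -> S y -> S z ->
    join x (join y z) = join (join x y) z;
  hey_joinC : forall x y, S x -> S y -> join x y = join y x;
  hey_joinKI : forall x y, S x -> S y -> meet x (join x y) = x;
  hey_meetKU : forall x y, S x -> S y -> join x (meet x y) = x
}.

Record inq_structure := InqStructure {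
  iq_sort :> Type;
  iq_core : set iq_sort;
  iq_meet : iq_sort -> iq_sort -> iq_sort;
  iq_join : iq_sort -> iq_sort -> iq_sort;
  iq_imp : iq_sort -> iq_sort -> iq_sort;
  iq_bot : iq_sort
}.

Inductive iq_gen (A : inq_structure) : set A :=
| iq_gen_core x : iq_core x -> iq_gen x
| iq_gen_bot : iq_gen (iq_bot A)
| iq_gen_meet x y : iq_gen x -> iq_gen y -> iq_gen (iq_meet x y)
| iq_gen_join x y : iq_gen x -> iq_gen y -> iq_gen (iq_join x y)
| iq_gen_imp x y : iq_gen x -> iq_gen y -> iq_gen (iq_imp x y).

Record inquisitive_algebra (A : inq_structure) : Prop := {
  iq_gen_heyting :
    heyting_on (@iq_gen A) (@iq_join A) (@iq_meet A) (@iq_imp A) (iq_bot A);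
  iq_core_brouwerian :
    brouwerian_on (@iq_core A) (@iq_meet A) (@iq_imp A) (iq_bot A);
  iq_split : forall a x y : A, iq_core a -> iq_gen x -> iq_gen y ->
    iq_imp a (iq_join x y) = iq_join (iq_imp a x) (iq_imp a y)
}.

Fixpoint iq_eval (At : Type) (A : inq_structure) (mu : At -> A)
    (phi : cl_formula At) : A :=
  match phi with
  | cl_var p => mu p
  | cl_bot => iq_bot A
  | cl_and psi chi => iq_meet (iq_eval mu psi) (iq_eval mu chi)
  | cl_or psi chi => iq_join (iq_eval mu psi) (iq_eval mu chi)
  | cl_imp psi chi => iq_imp (iq_eval mu psi) (iq_eval mu chi)
  end.

Definition iq_top (A : inq_structure) : A := iq_imp (iq_bot A) (iq_bot A).

Definition iq_core_valid (At : Type) (A : inq_structure)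
    (phi : cl_formula At) : Prop :=
  forall mu : At -> A, (forall p, iq_core (mu p)) -> iq_eval mu phi = iq_top A.

Record dep_structure := DepStructure {
  dp_sort :> Type;
  dp_core : set dp_sort;
  dp_meet : dp_sort -> dp_sort -> dp_sort;
  dp_tensor : dp_sort -> dp_sort -> dp_sort;
  dp_join : dp_sort -> dp_sort -> dp_sort;
  dp_imp : dp_sort -> dp_sort -> dp_sort;
  dp_bot : dp_sort
}.

Inductive dp_gen (A : dep_structure) : set A :=
| dp_gen_core x : dp_core x -> dp_gen x
| dp_gen_bot : dp_gen (dp_bot A)
| dp_gen_meet x y : dp_gen x -> dp_gen y -> dp_gen (dp_meet x y)
| dp_gen_tensor x y : dp_gen x -> dp_gen y -> dp_gen (dp_tensor x y)
| dp_gen_join x y : dp_gen x -> dp_gen y -> dp_gen (dp_join x y)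
| dp_gen_imp x y : dp_gen x -> dp_gen y -> dp_gen (dp_imp x y).

Definition dp_top (A : dep_structure) : A := dp_imp (dp_bot A) (dp_bot A).

(* Two points differ from the definition as printed in the source.
   - [dp_mono]: the printed law is the equation
       (x -> z) -> (y -> k) = (x (x) y) -> (z (x) k).
     At x = y = z = 1, k = 0 it reads 0 = 1 (on the core (x) is the lattice
     join), so only the one-element algebra would satisfy it, in which every
     formula is valid. It is read as the monotonicity law of the tensor,
       (x -> z) -> ((y -> k) -> ((x (x) y) -> (z (x) k))) = 1.
   - [dp_tensorC]: the commutativity of (x) on the generated subalgebra is not
     listed in the source. It does not follow from the other laws: on
     {0, a, b, a \/ b, 1} with core {0, a, b, 1} they all hold for a tensor
     with 0 (x) (a \/ b) = a \/ b but (a \/ b) (x) 0 = 1, which refutes the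
     formula (p \/ q) (x) _|_ -> p \/ q, valid in team semantics. *)
Record dependence_algebra (A : dep_structure) : Prop := {
  dp_gen_heyting :
    heyting_on (@dp_gen A) (@dp_join A) (@dp_meet A) (@dp_imp A) (dp_bot A);
  dp_core_heyting :
    heyting_on (@dp_core A) (@dp_tensor A) (@dp_meet A) (@dp_imp A) (dp_bot A);
  dp_split : forall a x y : A, dp_core a -> dp_gen x -> dp_gen y ->
    dp_imp a (dp_join x y) = dp_join (dp_imp a x) (dp_imp a y);
  dp_dist : forall x y z : A, dp_gen x -> dp_gen y -> dp_gen z ->
    dp_tensor x (dp_join y z) = dp_join (dp_tensor x y) (dp_tensor x z);
  dp_mono : forall x y z k : A,
    dp_gen x -> dp_gen y -> dp_gen z -> dp_gen k ->
    dp_imp (dp_imp x z)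
      (dp_imp (dp_imp y k) (dp_imp (dp_tensor x y) (dp_tensor z k)))
    = dp_top A;
  dp_tensorC : forall x y : A, dp_gen x -> dp_gen y ->
    dp_tensor x y = dp_tensor y x
}.

Definition well_connected (A : dep_structure) : Prop :=
  forall x y : A, dp_gen x -> dp_gen y ->
    dp_join x y = dp_top A -> x = dp_top A \/ y = dp_top A.

Fixpoint dp_eval (At : Type) (A : dep_structure) (mu : At -> A)
    (phi : clt_formula At) : A :=
  match phi with
  | clt_var p => mu p
  | clt_bot => dp_bot A
  | clt_and psi chi => dp_meet (dp_eval mu psi) (dp_eval mu chi)
  | clt_or psi chi => dp_join (dp_eval mu psi) (dp_eval mu chi)
  | clt_imp psi chi => dp_imp (dp_eval mu psi) (dp_eval mu chi)
  | clt_tensor psi chi => dp_tensor (dp_eval mu psi) (dp_eval mu chi)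
  end.

Definition dp_core_valid (At : Type) (A : dep_structure)
    (phi : clt_formula At) : Prop :=
  forall mu : At -> A, (forall p, dp_core (mu p)) -> dp_eval mu phi = dp_top A.

(* Main.v *)
Require Import Defs.
From mathcomp Require Import all_boot.
From mathcomp Require Import boolp classical_sets.

(** Every element generated by the core is a finite join of core elements,
    and support decomposes in the same way.  Given an algebra, take the frame
    of the filters of its core that are maximal among those avoiding some
    element, so that Zorn's lemma provides enough of them; they are prime when
    the core is a Heyting algebra.  There a formula that evaluates to
    [a_1 \/ ... \/ a_n] is supported by exactly the teams all of whose members
    contain one and the same [a_i].  If the team of all worlds supports the
    formula, then some [a_i] lies in all these filters, hence is [1].
    Conversely, the families of teams of a frame that are closed under subteams
    and successors form an algebra, with core the families of all subteams of a
    fixed up-set, in which a formula evaluates to the family of the teams that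
    support it; it is well-connected because a union of two such families is
    everything only if one of them contains the team of all worlds. *)

Set Implicit Arguments.
Unset Strict Implicit.
Unset Printing Implicit Defensive.

Local Open Scope classical_set_scope.

(** * Relativized Brouwerian semilattices and Heyting algebras *)

Section Brouwerian.
Variables (T : Type) (S : set T) (meet imp : T -> T -> T) (bot : T).
Hypothesis B : brouwerian_on S meet imp bot.

Local Notation "x <<= y" := (meet x y = x) (at level 70).
Local Notation top := (imp bot bot).

Lemma brw_top : S top.
Proof. by have S0 := brw_bot B; apply: (brw_imp B). Qed.

Lemma brw_anti x y : S x -> S y -> x <<= y -> y <<= x -> x = y.
Proof. by move=> Sx Sy xy yx; rewrite -xy (brw_meetC B). Qed.

Lemma brw_trans y x z : S x -> S y -> S z -> x <<= y -> y <<= z -> x <<= z.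
Proof. by move=> Sx Sy Sz xy yz; rewrite -{1}xy -(brw_meetA B)// yz. Qed.

Lemma brw_leIl x y : S x -> S y -> meet x y <<= x.
Proof.
move=> Sx Sy; have Sxy := brw_meet B Sx Sy.
by rewrite (brw_meetC B)// (brw_meetA B)// (brw_meetxx B).
Qed.

Lemma brw_leIr x y : S x -> S y -> meet x y <<= y.
Proof. by move=> Sx Sy; rewrite -(brw_meetA B)// (brw_meetxx B). Qed.

Lemma brw_lexI x y z : S x -> S y -> S z ->
  z <<= x -> z <<= y -> z <<= meet x y.
Proof. by move=> Sx Sy Sz zx zy; rewrite (brw_meetA B)// zx. Qed.

Lemma brw_leI2 x y x' y' : S x -> S y -> S x' -> S y' ->
  x <<= x' -> y <<= y' -> meet x y <<= meet x' y'.
Proof.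
move=> Sx Sy Sx' Sy' xx' yy'; have Sxy := brw_meet B Sx Sy.
apply: brw_lexI => //.
- exact: (@brw_trans x) (brw_leIl _ _) xx'.
- exact: (@brw_trans y) (brw_leIr _ _) yy'.
Qed.

Lemma brw_lex1 x : S x -> x <<= top.
Proof.
have S0 := brw_bot B; move=> Sx; apply/(brw_residuation B) => //.
exact: brw_leIr.
Qed.

Lemma brw_mp x y : S x -> S y -> meet (imp x y) x <<= y.
Proof.
move=> Sx Sy; have Si := brw_imp B Sx Sy.
by apply/(brw_residuation B) => //; apply: (brw_meetxx B).
Qed.

Lemma brw_imp_ge y x z : S x -> S y -> S z ->
  x <<= y -> imp y z <<= imp x z.
Proof.
move=> Sx Sy Sz xy; have Si := brw_imp B Sy Sz.
have Sm := brw_meet B Si Sx; have Sm' := brw_meet B Si Sy.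
apply/(brw_residuation B) => //.
apply: (@brw_trans (meet (imp y z) y)) (brw_mp _ _) => //.
by apply: brw_leI2 => //; apply: (brw_meetxx B).
Qed.

(** The laws are universally quantified, so a subset closed under the operations inherits them. The
    team core is later carved out of the closed families in this way. *)
Lemma brouwerian_sub (S' : set T) : S' `<=` S -> S' bot ->
  (forall x y, S' x -> S' y -> S' (meet x y)) ->
  (forall x y, S' x -> S' y -> S' (imp x y)) ->
  brouwerian_on S' meet imp bot.
Proof.
move=> sub S0 SI Si; split=> //.
- by move=> x y z /sub Sx /sub Sy /sub Sz; apply: (brw_meetA B).
- by move=> x y /sub Sx /sub Sy; apply: (brw_meetC B).
- by move=> x /sub; apply: (brw_meetxx B).
- by move=> x /sub; apply: (brw_le0x B).
- by move=> x y z /sub Sx /sub Sy /sub Sz; apply: (brw_residuation B).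
Qed.

End Brouwerian.

Section Heyting.
Variables (T : Type) (S : set T) (join meet imp : T -> T -> T) (bot : T).
Hypothesis H : heyting_on S join meet imp bot.
Let B := hey_brouwerian H.

Local Notation "x <<= y" := (meet x y = x) (at level 70).
Local Notation top := (imp bot bot).

Lemma hey_leUl x y : S x -> S y -> x <<= join x y.
Proof. exact: (hey_joinKI H). Qed.

Lemma hey_leUr x y : S x -> S y -> y <<= join x y.
Proof. by move=> Sx Sy; rewrite (hey_joinC H)//; apply: hey_leUl. Qed.

Lemma hey_leUx x y z : S x -> S y -> S z ->
  x <<= z -> y <<= z -> join x y <<= z.
Proof.
move=> Sx Sy Sz xz yz; have Sxy := hey_join H Sx Sy.
(* Absorption translates the order, which is given by meets, into an equation between joins. *)
have U u : S u -> u <<= z -> join u z = z.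
  move=> Su uz; rewrite (hey_joinC H)// -{1}uz (brw_meetC B)//.
  exact: (hey_meetKU H).
by rewrite -{1}(U x)// -{1}(U y)// (hey_joinA H)// (hey_joinKI H).
Qed.

Lemma hey_join1x x : S x -> join top x = top.
Proof.
move=> Sx; have St := brw_top B; have SU := hey_join H St Sx.
by apply: (brw_anti B) => //; [apply: (brw_lex1 B)|apply: hey_leUl].
Qed.

Lemma hey_joinx1 x : S x -> join x top = top.
Proof.
by move=> Sx; rewrite (hey_joinC H) ?hey_join1x//; apply: (brw_top B).
Qed.

(** Distributivity comes from residuation: [meet _ z] is a left adjoint, hence preserves joins. *)
Lemma hey_meetUl x y z : S x -> S y -> S z ->
  meet (join x y) z = join (meet x z) (meet y z).
Proof.
move=> Sx Sy Sz; have Sxy := hey_join H Sx Sy.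
have Sxz := brw_meet B Sx Sz; have Syz := brw_meet B Sy Sz.
have SU := hey_join H Sxz Syz; have Si := brw_imp B Sz SU.
have Sm := brw_meet B Sxy Sz.
apply: (brw_anti B) => //.
  apply/(brw_residuation B) => //; apply: hey_leUx => //.
  - by apply/(brw_residuation B) => //; apply: hey_leUl.
  - by apply/(brw_residuation B) => //; apply: hey_leUr.
have zz := brw_meetxx B Sz.
apply: hey_leUx => //; apply: (brw_leI2 B) => //.
- exact: hey_leUl.
- exact: hey_leUr.
Qed.

Lemma hey_meetUr x y z : S x -> S y -> S z ->
  meet z (join x y) = join (meet z x) (meet z y).
Proof.
move=> Sx Sy Sz; have Sxy := hey_join H Sx Sy.
by rewrite !(brw_meetC B Sz)// hey_meetUl.
Qed.

Lemma hey_impUl x y z : S x -> S y -> S z ->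
  imp (join x y) z = meet (imp x z) (imp y z).
Proof.
move=> Sx Sy Sz; have Sxy := hey_join H Sx Sy.
have Sxz := brw_imp B Sx Sz; have Syz := brw_imp B Sy Sz.
have Sm := brw_meet B Sxz Syz; have Si := brw_imp B Sxy Sz.
have SmU := brw_meet B Sm Sxy; have Smx := brw_meet B Sm Sx.
have Smy := brw_meet B Sm Sy.
apply: (brw_anti B) => //.
  apply: (brw_lexI B) => //; apply: (brw_imp_ge B) => //.
  - exact: hey_leUl.
  - exact: hey_leUr.
apply: (brw_residuation B Sm Sxy Sz).1; rewrite hey_meetUr//.
apply: hey_leUx => //; apply/(brw_residuation B) => //.
- exact: (brw_leIl B).
- exact: (brw_leIr B).
Qed.

Lemma heyting_sub (S' : set T) : S' `<=` S -> S' bot ->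
  (forall x y, S' x -> S' y -> S' (meet x y)) ->
  (forall x y, S' x -> S' y -> S' (imp x y)) ->
  (forall x y, S' x -> S' y -> S' (join x y)) ->
  heyting_on S' join meet imp bot.
Proof.
move=> sub S0 SI Si SU; split=> //.
- exact: (brouwerian_sub B).
- by move=> x y z /sub Sx /sub Sy /sub Sz; apply: (hey_joinA H).
- by move=> x y /sub Sx /sub Sy; apply: (hey_joinC H).
- by move=> x y /sub Sx /sub Sy; apply: (hey_joinKI H).
- by move=> x y /sub Sx /sub Sy; apply: (hey_meetKU H).
Qed.

End Heyting.

(** * Families of teams *)

Section Teams.
Variable F : kripke_frame.
Implicit Types (X Y Z : set (set F)) (U : set F) (t s : set F).

Definition team_bot : set (set F) := [set t | t = set0].

Definition team_imp X Y : set (set F) :=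
  [set t | forall s, s `<=` acc_image t -> X s -> Y s].

Definition team_tensor X Y : set (set F) :=
  [set t | exists s r, [/\ s `<=` t, r `<=` t, s `|` r = t, X s & Y r]].

Definition subteams U : set (set F) := [set t | t `<=` U].

Definition upset U := forall w v : F, U w -> acc w v -> U v.

(** Accessibility being reflexive, the second clause covers subteams as well as teams of successors.
    The two clauses express the empty team property and the persistence of support. *)
Definition closed_family X :=
  X set0 /\ forall t s, X t -> s `<=` acc_image t -> X s.

Lemma sub_acc_image t : t `<=` acc_image t.
Proof. by move=> w tw; exists w => //; apply: acc_refl. Qed.

Lemma acc_image_sub t s : s `<=` acc_image t -> acc_image s `<=` acc_image t.
Proof.
move=> st v [w /st[u tu uw] wv]; exists u => //; exact: acc_trans uw wv.
Qed.

Lemma closed_subset X t s : closed_family X -> X t -> s `<=` t -> X s.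
Proof.
by move=> [_ cX] Xt st; apply: cX Xt _ => w /st; apply: sub_acc_image.
Qed.

Lemma closed_team_bot : closed_family team_bot.
Proof.
split=> // t s /= -> s0; rewrite /team_bot /=.
by apply/seteqP; split => // w /s0[].
Qed.

Lemma closed_setI X Y :
  closed_family X -> closed_family Y -> closed_family (X `&` Y).
Proof.
move=> [X0 cX] [Y0 cY]; split=> // t s [Xt Yt] st.
by split; [apply: cX Xt st|apply: cY Yt st].
Qed.

Lemma closed_setU X Y :
  closed_family X -> closed_family Y -> closed_family (X `|` Y).
Proof.
move=> [X0 cX] [Y0 cY]; split; first by left.
by move=> t s [Xt|Yt] st; [left; apply: cX Xt st|right; apply: cY Yt st].
Qed.

Lemma closed_team_imp X Y : closed_family Y -> closed_family (team_imp X Y).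
Proof.
move=> [Y0 cY]; split.
  move=> s s0 _; suff -> : s = set0 by [].
  by apply/seteqP; split=> // w /s0[].
move=> t s XYt st r rs Xr; apply: XYt Xr => w /rs.
exact: acc_image_sub.
Qed.

Lemma closed_team_tensor X Y :
  closed_family X -> closed_family Y -> closed_family (team_tensor X Y).
Proof.
move=> [X0 cX] [Y0 cY]; split.
  by exists set0, set0; split=> //; rewrite setUid.
move=> t s [p [q [pt qt E Xp Yq]]] st.
(* A point of [s] succeeds a point of [t], which lies in [p] or in [q]; this puts it into the
   corresponding part of [s]. *)
exists (s `&` acc_image p), (s `&` acc_image q); split.
- by move=> ? [].
- by move=> ? [].
- apply/seteqP; split=> [w [|] []//|w sw].
  have [u tu uw] := st _ sw.
  by move: tu; rewrite -E => -[pu|qu]; [left|right]; split => //; exists u.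
- by apply: cX Xp _ => ? [].
- by apply: cY Yq _ => ? [].
Qed.

Lemma closed_subteams U : upset U -> closed_family (subteams U).
Proof.
move=> uU; split=> [?//|t s tU st w /st[u /tU Uu uw]].
exact: uU Uu uw.
Qed.

Lemma subteams0 : subteams set0 = team_bot.
Proof. by apply/seteqP; split=> t /=; rewrite /subteams /= subset0. Qed.

Lemma subteamsI U U' : subteams U `&` subteams U' = subteams (U `&` U').
Proof. by apply/seteqP; split=> t /=; rewrite /subteams /= subsetI. Qed.

(** This is why the tensor, and not the union of families, serves as the join of the core. *)
Lemma subteams_tensor U U' :
  team_tensor (subteams U) (subteams U') = subteams (U `|` U').
Proof.
apply/seteqP; split=> t /=.
  move=> [s [r [_ _ <- sU rU']]] w [/sU|/rU'] ?; [by left|by right].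
move=> tU; exists (t `&` U), (t `&` U'); split; try by move=> ? [].
by rewrite -setIUr; apply/setIidPl.
Qed.

Definition upset_imp U U' : set F :=
  [set w | forall v, acc w v -> U v -> U' v].

Lemma subteams_imp U U' :
  team_imp (subteams U) (subteams U') = subteams (upset_imp U U').
Proof.
apply/seteqP; split=> t /=.
  (* A singleton team tests the implication at a single successor. *)
  move=> h w tw v wv Uv; apply: (h [set v]) => // _ ->//.
  by exists w.
by move=> h s st sU v sv; have [w /h hw wv] := st _ sv; apply: hw wv (sU _ sv).
Qed.

Definition team_core : set (set (set F)) :=
  [set X | exists2 U, upset U & X = subteams U].

Lemma core_closed X : team_core X -> closed_family X.
Proof. by move=> [U uU ->]; apply: closed_subteams. Qed.

Lemma core_team_bot : team_core team_bot.
Proof. by exists set0; rewrite ?subteams0. Qed.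

Lemma core_setI X Y : team_core X -> team_core Y -> team_core (X `&` Y).
Proof.
move=> [U uU ->] [U' uU' ->]; exists (U `&` U'); last by rewrite subteamsI.
by move=> w v [? ?] wv; split; [apply: uU wv|apply: uU' wv].
Qed.

Lemma core_team_tensor X Y :
  team_core X -> team_core Y -> team_core (team_tensor X Y).
Proof.
move=> [U uU ->] [U' uU' ->].
exists (U `|` U'); last by rewrite subteams_tensor.
by move=> w v [?|?] wv; [left; apply: uU wv|right; apply: uU' wv].
Qed.

Lemma core_team_imp X Y : team_core X -> team_core Y -> team_core (team_imp X Y).
Proof.
move=> [U uU ->] [U' uU' ->].
exists (upset_imp U U'); last by rewrite subteams_imp.
by move=> w v h wv u vu; apply: h; apply: acc_trans wv vu.
Qed.

(** Among the teams of successors of [t] that lie in [U] there is a largest one, [acc_image t] cut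
    down to [U]. The disjunct that holds there passes to all its subteams. *)
Lemma team_imp_subteamsU U X Y : closed_family X -> closed_family Y ->
  team_imp (subteams U) (X `|` Y) =
  team_imp (subteams U) X `|` team_imp (subteams U) Y.
Proof.
move=> cX cY; apply/seteqP; split=> t /=; last first.
  by case=> h s st sU; [left|right]; apply: h.
move=> h; have [||h'|h'] := h (acc_image t `&` U); try by move=> ? [].
- by left=> s st sU; apply: (closed_subset cX h') => w sw; split; auto.
- by right=> s st sU; apply: (closed_subset cY h') => w sw; split; auto.
Qed.

Lemma team_impUl X Y Z :
  team_imp (X `|` Y) Z = team_imp X Z `&` team_imp Y Z.
Proof.
apply/seteqP; split=> t /=.
- by move=> h; split=> s st Xs; apply: h => //; [left|right].
- by move=> [h1 h2] s st [Xs|Ys]; [apply: h1|apply: h2].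
Qed.

Lemma team_tensorC X Y : team_tensor X Y = team_tensor Y X.
Proof.
suff E A B : team_tensor A B `<=` team_tensor B A.
  by apply/seteqP; split; apply: E.
by move=> t [s [r [? ? ? ? ?]]]; exists r, s; split=> //; rewrite setUC.
Qed.

Lemma team_tensorUr X Y Z :
  team_tensor X (Y `|` Z) = team_tensor X Y `|` team_tensor X Z.
Proof.
apply/seteqP; split=> t /=.
  by move=> [s [r [? ? ? ? [?|?]]]]; [left|right]; exists s, r.
by case=> [] [s [r [? ? ? ? ?]]]; exists s, r; split=> //; [left|right].
Qed.

Lemma team_imp_bot : team_imp team_bot team_bot = setT.
Proof. by apply/seteqP; split=> // t _ s. Qed.

Lemma team_brouwerian :
  brouwerian_on closed_family (@setI (set F)) team_imp team_bot.
Proof.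
split.
- exact: closed_team_bot.
- exact: closed_setI.
- by move=> X Y _; apply: closed_team_imp.
- by move=> X Y Z _ _ _; rewrite setIA.
- by move=> X Y _ _; rewrite setIC.
- by move=> X _; rewrite setIid.
- by move=> X [X0 _]; apply/setIidPl => t ->.
(* Residuation: one direction uses that [X] is closed under successors, the other that every team is
   among its own successor teams. *)
- move=> X Y Z [X0 cX] _ _; split=> /setIidPl h; apply/setIidPl => t.
  + by move=> Xt s st Ys; apply: h; split => //; apply: cX Xt st.
  + by move=> [Xt Yt]; apply: (h _ Xt) Yt; apply: sub_acc_image.
Qed.

Lemma team_heyting :
  heyting_on closed_family (@setU (set F)) (@setI (set F)) team_imp team_bot.
Proof.
split.
- exact: team_brouwerian.
- exact: closed_setU.
- by move=> X Y Z _ _ _; rewrite setUA.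
- by move=> X Y _ _; rewrite setUC.
- by move=> X Y _ _; apply/setIidPl => t; left.
- by move=> X Y _ _; apply/setUidPl => t [].
Qed.

Lemma team_core_brouwerian :
  brouwerian_on team_core (@setI (set F)) team_imp team_bot.
Proof.
apply: (brouwerian_sub team_brouwerian).
- exact: core_closed.
- exact: core_team_bot.
- exact: core_setI.
- exact: core_team_imp.
Qed.

Lemma team_core_heyting :
  heyting_on team_core team_tensor (@setI (set F)) team_imp team_bot.
Proof.
split.
- exact: team_core_brouwerian.
- exact: core_team_tensor.
- by move=> _ _ _ [U _ ->] [U' _ ->] [U2 _ ->]; rewrite !subteams_tensor setUA.
- by move=> X Y _ _; apply: team_tensorC.
- move=> _ _ [U _ ->] [U' _ ->]; rewrite subteams_tensor subteamsI.
  by congr subteams; apply/setIidPl => w; left.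
- move=> _ _ [U _ ->] [U' _ ->]; rewrite subteamsI subteams_tensor.
  by congr subteams; apply/setUidPl => w [].
Qed.

(** * The algebras of teams of a frame *)

Definition team_inq : inq_structure :=
  InqStructure team_core (@setI (set F)) (@setU (set F)) team_imp team_bot.

Definition team_dep : dep_structure :=
  DepStructure team_core (@setI (set F)) team_tensor (@setU (set F))
    team_imp team_bot.

Lemma team_inq_gen_closed (X : team_inq) : iq_gen X -> closed_family X.
Proof.
elim=> {X} [X /core_closed//||X Y _ cX _ cY|X Y _ cX _ cY|X Y _ cX _ cY].
- exact: closed_team_bot.
- exact: closed_setI.
- exact: closed_setU.
- exact: closed_team_imp.
Qed.

Lemma team_dep_gen_closed (X : team_dep) : dp_gen X -> closed_family X.
Proof.
elim=> {X} [X /core_closed//|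
  |X Y _ cX _ cY|X Y _ cX _ cY|X Y _ cX _ cY|X Y _ cX _ cY].
- exact: closed_team_bot.
- exact: closed_setI.
- exact: closed_team_tensor.
- exact: closed_setU.
- exact: closed_team_imp.
Qed.

Lemma team_inq_algebra : inquisitive_algebra team_inq.
Proof.
split.
- apply: (heyting_sub team_heyting).
  + exact: team_inq_gen_closed.
  + exact: (@iq_gen_bot team_inq).
  + exact: (@iq_gen_meet team_inq).
  + exact: (@iq_gen_imp team_inq).
  + exact: (@iq_gen_join team_inq).
- exact: team_core_brouwerian.
- move=> _ X Y [U _ ->] /team_inq_gen_closed cX /team_inq_gen_closed cY.
  exact: team_imp_subteamsU.
Qed.

Lemma team_dep_algebra : dependence_algebra team_dep.
Proof.
split.
- apply: (heyting_sub team_heyting).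
  + exact: team_dep_gen_closed.
  + exact: (@dp_gen_bot team_dep).
  + exact: (@dp_gen_meet team_dep).
  + exact: (@dp_gen_imp team_dep).
  + exact: (@dp_gen_join team_dep).
- exact: team_core_heyting.
- move=> _ X Y [U _ ->] /team_dep_gen_closed cX /team_dep_gen_closed cY.
  exact: team_imp_subteamsU.
- by move=> X Y Z _ _ _; apply: team_tensorUr.
- move=> X Y Z K _ _ _ _; rewrite /dp_top /= team_imp_bot.
  apply/seteqP; split=> // t _ s _ XZ r rs YK q qr [q1 [q2 [q1q q2q E X1 Y2]]].
  (* The same splitting of [q] serves for the conclusion: [q1] is reached from [s] through [r], and
     [q2] directly from [r]. *)
  exists q1, q2; split=> //.
    apply: XZ X1 => w /q1q/qr; exact: acc_image_sub.
  by apply: YK Y2 => w /q2q/qr.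
- by move=> X Y _ _; apply: team_tensorC.
Qed.

Lemma team_dep_well_connected : well_connected team_dep.
Proof.
move=> X Y /team_dep_gen_closed cX /team_dep_gen_closed cY.
rewrite /dp_top /= team_imp_bot => E.
have full Z : closed_family Z -> Z setT -> Z = setT.
  by move=> cZ ZT; apply/seteqP; split=> // t _; apply: closed_subset ZT _.
have [XT|YT] : (X `|` Y) setT by rewrite E.
- by left; apply: full.
- by right; apply: full.
Qed.

End Teams.

(** * Evaluation in the algebras of teams *)

Section TeamEval.
Variables (At : Type) (F : kripke_frame) (V : F -> set At).

Let mu p : set (set F) := subteams [set w | V w p].

(** The operations on families repeat the clauses of support, so every case is a rewriting. *)
Lemma team_inq_eval (phi : cl_formula At) :
  iq_eval (A := team_inq F) mu phi = [set t | cl_support V t phi].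
Proof. by elim: phi => //= [a -> b ->|a -> b ->|a -> b ->]. Qed.

Lemma team_dep_eval (phi : clt_formula At) :
  dp_eval (A := team_dep F) mu phi = [set t | clt_support V t phi].
Proof. by elim: phi => //= [a -> b ->|a -> b ->|a -> b ->|a -> b ->]. Qed.

Hypothesis pV : persistent V.

Lemma core_valuation p : team_core (mu p).
Proof. by exists [set w | V w p] => // w v; apply: pV. Qed.

Lemma team_inq_valid (phi : cl_formula At) :
  iq_core_valid (team_inq F) phi -> forall t, cl_support V t phi.
Proof.
move=> /(_ mu core_valuation); rewrite team_inq_eval /iq_top /= team_imp_bot.
by move=> E t; have : setT t by []; rewrite -E.
Qed.

Lemma team_dep_valid (phi : clt_formula At) :
  dp_core_valid (team_dep F) phi -> forall t, clt_support V t phi.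
Proof.
move=> /(_ mu core_valuation); rewrite team_dep_eval /dp_top /= team_imp_bot.
by move=> E t; have : setT t by []; rewrite -E.
Qed.

End TeamEval.

(** * The frame of irreducible filters *)

Section Canonical.
Variables (T : Type) (C : set T) (meet imp : T -> T -> T) (bot : T).
Hypothesis B : brouwerian_on C meet imp bot.

Local Notation "x <<= y" := (meet x y = x) (at level 70).
Local Notation top := (imp bot bot).

Record filter (f : set T) : Prop := Filter {
  filter_sub : f `<=` C;
  filter_top : f top;
  filter_meet : forall x y, f x -> f y -> f (meet x y);
  filter_up : forall x y, f x -> C y -> x <<= y -> f y
}.

Definition maximal_avoiding (a : T) (f : set T) :=
  [/\ filter f, ~ f a & forall g, filter g -> f `<=` g -> ~ g a -> g `<=` f].

(** These are the completely meet-irreducible filters. They replace prime filters, since a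
    Brouwerian semilattice need not have joins. *)
Definition irreducible (f : set T) := exists2 a, C a & maximal_avoiding a f.

Lemma maximal_avoiding_exists f a : filter f -> ~ f a ->
  exists2 g, maximal_avoiding a g & f `<=` g.
Proof.
move=> ff fa.
(* The empty set is admitted in [P] so that [P] is closed under the union of
   the empty chain. *)
pose P (g : set T) := (g = set0 \/ (filter g /\ f `<=` g)) /\ ~ g a.
have [|g [[[g0|[fg sfg]] ga] max]] := @Zorn_bigcup T P.
- move=> ch chP tot; split; last by move=> [X /chP[_ nXa] Xa].
  have E X : ch X -> X !=set0 -> filter X /\ f `<=` X.
    by move=> /chP[[->|//] _] [].
  have [[x0 [X0 cX0 X0x0]]|/set0P/negP/negPn/eqP->] :=
    pselect ((\bigcup_(X in ch) X) !=set0); last by left.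
  have [fX0 sX0] := E _ cX0 (ex_intro _ x0 X0x0).
  right; split; last by move=> x /sX0; exists X0.
  split.
  + move=> x [X cX Xx]; have [fX _] := E _ cX (ex_intro _ x Xx).
    exact: filter_sub fX _ Xx.
  + by exists X0 => //; apply: filter_top.
  + move=> x y [X cX Xx] [Y cY Yy].
    have [fX _] := E _ cX (ex_intro _ x Xx).
    have [fY _] := E _ cY (ex_intro _ y Yy).
    have [XY|YX] := tot _ _ cX cY.
    * by exists Y => //; apply: (filter_meet fY) => //; apply: XY.
    * by exists X => //; apply: (filter_meet fX) => //; apply: YX.
  + move=> x y [X cX Xx] Cy xy; have [fX _] := E _ cX (ex_intro _ x Xx).
    by exists X => //; apply: (filter_up fX Xx Cy xy).
(* The maximal set is not empty, for [f] belongs to [P] and contains [top]. *)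
- exfalso; apply: (max f); last by split=> //; right; split.
  rewrite g0; split=> // /(_ _ (filter_top ff)).
  exact.
- exists g => //; split=> // h fh gh nha x hx; apply: contrapT => ngx.
  apply: (max h); last by split=> //; right; split=> // y /sfg/gh.
  by split=> // /(_ _ hx).
Qed.

(** The filter generated by [f] and [a], when [f] is a filter and [a] is in [C]. *)
Definition filter_adjoin (f : set T) (a : T) : set T :=
  [set c | C c /\ exists2 b, f b & meet b a <<= c].

Lemma filter_adjoinP f a : filter f -> C a -> filter (filter_adjoin f a).
Proof.
move=> ff Ca; have St := brw_top B; split.
- by move=> x [].
- split=> //; exists top; first exact: filter_top.
  by apply: (brw_lex1 B); apply: (brw_meet B).
- move=> x y [Cx [b fb bx]] [Cy [c fc cy]].
  have Cb := filter_sub ff fb; have Cc := filter_sub ff fc.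
  have Cbc := brw_meet B Cb Cc; have Cba := brw_meet B Cb Ca.
  have Cca := brw_meet B Cc Ca; have Cbca := brw_meet B Cbc Ca.
  have aa := brw_meetxx B Ca.
  split; first exact: (brw_meet B).
  exists (meet b c); first exact: filter_meet.
  apply: (brw_lexI B) => //.
  + apply: (brw_trans B (y := meet b a)) bx => //.
    by apply: (brw_leI2 B) => //; apply: (brw_leIl B).
  + apply: (brw_trans B (y := meet c a)) cy => //.
    by apply: (brw_leI2 B) => //; apply: (brw_leIr B).
- move=> x y [Cx [b fb bx]] Cy xy; split=> //; exists b => //.
  have Cb := filter_sub ff fb; have Cba := brw_meet B Cb Ca.
  exact: (brw_trans B (y := x)) bx xy.
Qed.

Lemma sub_filter_adjoin f a : filter f -> C a -> f `<=` filter_adjoin f a.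
Proof.
move=> ff Ca x fx; have Cx := filter_sub ff fx; split=> //.
by exists x => //; apply: (brw_leIl B).
Qed.

Lemma mem_filter_adjoin f a : filter f -> C a -> filter_adjoin f a a.
Proof.
move=> ff Ca; split=> //; exists top; first exact: filter_top.
by apply: (brw_leIr B) => //; apply: (brw_top B).
Qed.

Lemma filter_mp f a b : filter f -> C a -> C b ->
  f (imp a b) -> f a -> f b.
Proof.
move=> ff Ca Cb fab fa.
exact: (filter_up ff (filter_meet ff fab fa) Cb (brw_mp B Ca Cb)).
Qed.

(** * The canonical frame and membership in its worlds *)

Definition canonical : kripke_frame.
Proof.
apply: (@KripkeFrame {f : set T | irreducible f}
  (fun f g => sval f `<=` sval g)).
- by move=> f.
- by move=> f g h fg gh x /fg/gh.
- move=> [f pf] [g pg] /= fg gf.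
  have E : f = g by apply/seteqP.
  by move: pf pg fg gf; rewrite E => pf pg _ _; rewrite (Prop_irrelevance pf pg).
Defined.

Definition contains (w : canonical) : set T := sval w.

Lemma contains_irreducible w : irreducible (contains w).
Proof. exact: svalP w. Qed.

Lemma contains_filter w : filter (contains w).
Proof. by have [a _ []] := contains_irreducible w. Qed.

Lemma contains_upset a : upset (fun w => contains w a).
Proof. by move=> w v wa wv; apply: wv. Qed.

Lemma contains_extend f a : filter f -> C a -> ~ f a ->
  exists2 w : canonical, f `<=` contains w & ~ contains w a.
Proof.
move=> ff Ca fa; have [g mg fg] := maximal_avoiding_exists ff fa.
have ig : irreducible g by exists a.
by exists (exist _ g ig) => //; case: mg.
Qed.

Lemma contains_bot w : ~ contains w bot.
Proof.
have [a Ca [fw nwa _]] := contains_irreducible w => w0; apply: nwa.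
by apply: (filter_up fw w0 Ca); apply: (brw_le0x B).
Qed.

Lemma contains_meet w a b : C a -> C b ->
  contains w (meet a b) <-> contains w a /\ contains w b.
Proof.
move=> Ca Cb; have fw := contains_filter w; split=> [wab|[]].
  split; first exact: (filter_up fw wab Ca (brw_leIl B Ca Cb)).
  exact: (filter_up fw wab Cb (brw_leIr B Ca Cb)).
exact: filter_meet.
Qed.

(** If [imp a b] is not in [w], then by residuation the filter generated by [w] and [a] still avoids
    [b], and it extends to a world that avoids [b]. *)
Lemma contains_imp w a b : C a -> C b ->
  contains w (imp a b) <->
  forall v : canonical, acc w v -> contains v a -> contains v b.
Proof.
move=> Ca Cb; have fw := contains_filter w; split.
  move=> wab v wv; apply: (filter_mp (contains_filter v)) => //; exact: wv.
move=> h; apply: contrapT => nab.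
have fa := filter_adjoinP fw Ca.
have [|v wv nvb] := contains_extend fa Cb.
  move=> [_ [c wc cab]]; apply: nab.
  have Cc := filter_sub fw wc.
  apply: (filter_up fw wc); first exact: (brw_imp B).
  exact/(brw_residuation B).
apply: nvb; apply: h; last by apply: wv; apply: mem_filter_adjoin.
by move=> x wx; apply: wv; apply: sub_filter_adjoin wx.
Qed.

(** Otherwise the least filter, consisting of [top] alone, avoids [a] and extends to a world that
    does. *)
Lemma contains_all a : C a -> (forall w, contains w a) -> a = top.
Proof.
move=> Ca h; have Ct := brw_top B; apply: contrapT => na.
have f1 : filter [set top].
  split=> [x ->//|//|x y -> ->|x y -> Cy /= ty]; first exact: (brw_meetxx B).
  by apply: (brw_anti B) => //; apply: (brw_lex1 B).
by have [w _] := contains_extend f1 Ca na; apply.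
Qed.

(** Primeness: if [w] contained neither [a] nor [b], it would contain the implications from both to
    the avoided element [d], hence the one from their join, hence [d]. The [join] will be the tensor
    of a dependence algebra. *)
Lemma contains_join (join : T -> T -> T) w a b :
  heyting_on C join meet imp bot -> C a -> C b ->
  contains w (join a b) <-> contains w a \/ contains w b.
Proof.
move=> H Ca Cb; have fw := contains_filter w.
have CU := hey_join H Ca Cb; split; last first.
  case=> h; apply: (filter_up fw h CU); first exact: (hey_leUl H).
  exact: (hey_leUr H).
have [d Cd [_ nwd max]] := contains_irreducible w => wab.
apply: contrapT => /not_orP[nwa nwb].
(* By maximality [d] is reached as soon as [a] or [b] is adjoined to [w]. *)
have key x : C x -> ~ contains w x -> contains w (imp x d).
  move=> Cx nx; have fx := filter_adjoinP fw Cx.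
  have : filter_adjoin (contains w) x d.
    apply: contrapT => nd; apply: nx.
    apply: (max _ fx _ nd); first exact: sub_filter_adjoin.
    exact: mem_filter_adjoin.
  move=> [_ [c wc cxd]]; have Cc := filter_sub fw wc.
  apply: (filter_up fw wc); first exact: (brw_imp B).
  exact/(brw_residuation B).
apply: nwd; apply: (filter_mp fw CU Cd _ wab).
by rewrite (hey_impUl H) => //; apply: filter_meet => //; apply: key.
Qed.

(** This lemma and the next three turn the operations on core elements into those on families; they
    are the base cases for resolutions. *)
Lemma bot_teams : subteams (fun w => contains w bot) = @team_bot canonical.
Proof.
rewrite -subteams0; congr subteams; apply/seteqP; split=> // w.
exact: contains_bot.
Qed.

Lemma meet_teams a b : C a -> C b ->
  subteams (fun w => contains w (meet a b)) =
  subteams (fun w => contains w a) `&` subteams (fun w => contains w b).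
Proof.
move=> Ca Cb; rewrite subteamsI; congr subteams.
by apply/seteqP; split=> w /contains_meet; apply.
Qed.

Lemma imp_teams a b : C a -> C b ->
  subteams (fun w => contains w (imp a b)) =
  team_imp (subteams (fun w => contains w a)) (subteams (fun w => contains w b)).
Proof.
move=> Ca Cb; rewrite subteams_imp; congr subteams.
by apply/seteqP; split=> w /contains_imp; apply.
Qed.

Lemma join_teams (join : T -> T -> T) a b :
  heyting_on C join meet imp bot -> C a -> C b ->
  subteams (fun w => contains w (join a b)) =
  team_tensor (subteams (fun w => contains w a))
    (subteams (fun w => contains w b)).
Proof.
move=> H Ca Cb; rewrite subteams_tensor; congr subteams.
by apply/seteqP; split=> w /(contains_join _ H Ca Cb).
Qed.

End Canonical.

(** * Resolutions *)

Section Resolution.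
Variables (T : Type) (C G : set T) (join meet imp : T -> T -> T) (bot : T).
Hypothesis H : heyting_on G join meet imp bot.
Hypothesis B : brouwerian_on C meet imp bot.
Hypothesis CG : C `<=` G.
Hypothesis split_imp : forall a x y, C a -> G x -> G y ->
  imp a (join x y) = join (imp a x) (imp a y).

Local Notation top := (imp bot bot).
Local Notation F := (canonical C meet imp bot).

(* [resolved x X]: [x] is a finite join of core elements and [X] is the family
   of the teams whose members all contain one and the same of them. *)
Inductive resolved : T -> set (set F) -> Prop :=
| resolved_core a : C a -> resolved a (subteams (fun w => contains w a))
| resolved_join x y X Y : resolved x X -> resolved y Y ->
    resolved (join x y) (X `|` Y).

Lemma resolved_gen x X : resolved x X -> G x.
Proof.
elim=> [a /CG//|{}x y {}X Y _ Gx _ Gy]; exact: (hey_join H).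
Qed.

Lemma resolved_closed x X : resolved x X -> closed_family X.
Proof.
elim=> [a _|{}x y {}X Y _ cX _ cY]; last exact: closed_setU.
by apply: closed_subteams; apply: contains_upset.
Qed.

Lemma resolved_bot : resolved bot (@team_bot F).
Proof.
rewrite -(bot_teams B); apply: resolved_core; exact: (brw_bot B).
Qed.

(** Distributivity holds in [G] and for families alike, which reduces both arguments to core
    elements. *)
Lemma resolved_meet x y X Y : resolved x X -> resolved y Y ->
  resolved (meet x y) (X `&` Y).
Proof.
move=> rx ry; have Gy := resolved_gen ry.
elim: rx => {x X} [a Ca|x x' X X' rx hx rx' hx'].
  have Ga := CG Ca; elim: ry {Gy} => {y Y} [b Cb|y y' Y Y' ry hy ry' hy'].
    by rewrite -(meet_teams B)//; apply: resolved_core; apply: (brw_meet B).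
  have Gy := resolved_gen ry; have Gy' := resolved_gen ry'.
  by rewrite (hey_meetUr H)// setIUr; apply: resolved_join.
have Gx := resolved_gen rx; have Gx' := resolved_gen rx'.
by rewrite (hey_meetUl H)// setIUl; apply: resolved_join.
Qed.

(** The antecedent is decomposed first, its joins becoming meets of implications. Once it is a core
    element, [split_imp] distributes it over the joins of the consequent. *)
Lemma resolved_imp x y X Y : resolved x X -> resolved y Y ->
  resolved (imp x y) (team_imp X Y).
Proof.
move=> rx ry; have Gy := resolved_gen ry.
elim: rx => {x X} [a Ca|x x' X X' rx hx rx' hx'].
  elim: ry {Gy} => {y Y} [b Cb|y y' Y Y' ry hy ry' hy'].
    by rewrite -(imp_teams B)//; apply: resolved_core; apply: (brw_imp B).
  have Gy := resolved_gen ry; have Gy' := resolved_gen ry'.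
  have cY := resolved_closed ry; have cY' := resolved_closed ry'.
  by rewrite split_imp// team_imp_subteamsU//; apply: resolved_join.
have Gx := resolved_gen rx; have Gx' := resolved_gen rx'.
by rewrite (hey_impUl H)// team_impUl; apply: resolved_meet.
Qed.

Lemma resolved_tensor (tensor : T -> T -> T) x y X Y :
  heyting_on C tensor meet imp bot ->
  (forall x y z, G x -> G y -> G z ->
     tensor x (join y z) = join (tensor x y) (tensor x z)) ->
  (forall x y, G x -> G y -> tensor x y = tensor y x) ->
  resolved x X -> resolved y Y -> resolved (tensor x y) (team_tensor X Y).
Proof.
move=> HC tensorUr tensorC rx ry; have Gy := resolved_gen ry.
elim: rx => {x X} [a Ca|x x' X X' rx hx rx' hx'].
  have Ga := CG Ca; elim: ry {Gy} => {y Y} [b Cb|y y' Y Y' ry hy ry' hy'].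
    by rewrite -(join_teams B HC)//; apply: resolved_core; apply: (hey_join HC).
  have Gy := resolved_gen ry; have Gy' := resolved_gen ry'.
  by rewrite tensorUr// team_tensorUr; apply: resolved_join.
have Gx := resolved_gen rx; have Gx' := resolved_gen rx'.
have GU := hey_join H Gx Gx'.
(* Distributivity is given for the right argument; commutativity carries it over to the left one. *)
rewrite tensorC// tensorUr// !(tensorC y)// team_tensorC team_tensorUr.
by rewrite !(team_tensorC Y); apply: resolved_join.
Qed.

(** A union contains the team of all worlds only if one of its members does. This descends to a core
    element that lies in every world, and [contains_all] applies. *)
Lemma resolved_top x X : resolved x X -> X setT -> x = top.
Proof.
elim=> {x X} [a Ca h|x y X Y rx hx ry hy].
  by apply: (contains_all B) => // w; apply: h.
have Gx := resolved_gen rx; have Gy := resolved_gen ry.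
case=> h; first by rewrite hx// (hey_join1x H).
by rewrite hy// (hey_joinx1 H).
Qed.

End Resolution.

(** * From validity in frames to validity in algebras *)

Lemma inq_soundness (At : Type) (phi : cl_formula At) :
  (forall F : kripke_frame, cl_frame_valid F phi) ->
  forall A : inq_structure, inquisitive_algebra A -> iq_core_valid A phi.
Proof.
move=> val A [H B split] mu Cmu.
have CG := @iq_gen_core A.
(* The canonical valuation: a variable is true at the filters that contain its value. *)
pose V (w : canonical (@iq_core A) (@iq_meet A) (@iq_imp A) (iq_bot A)) :=
  [set p | contains w (mu p)].
have pV : persistent V by move=> p w v; apply: contains_upset.
(* The truth lemma, by induction on [phi], resolves the value of [phi] by the family of its
   supporting teams. Validity puts the team of all worlds into this family. *)
apply: (resolved_top H B CG (X := [set t | cl_support V t phi])); last exact: val.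
elim: phi {val} => [p||a ha b hb|a ha b hb|a ha b hb].
- exact: (resolved_core _ _ _ _ (Cmu p)).
- exact: (resolved_bot _ B).
- exact: (resolved_meet H B CG ha hb).
- exact: resolved_join ha hb.
- exact: (resolved_imp H B CG split ha hb).
Qed.

Lemma dep_soundness (At : Type) (phi : clt_formula At) :
  (forall F : kripke_frame, clt_frame_valid F phi) ->
  forall A : dep_structure, dependence_algebra A -> dp_core_valid A phi.
Proof.
move=> val A [H HC split dist _ tensorC] mu Cmu.
have B := hey_brouwerian HC; have CG := @dp_gen_core A.
pose V (w : canonical (@dp_core A) (@dp_meet A) (@dp_imp A) (dp_bot A)) :=
  [set p | contains w (mu p)].
have pV : persistent V by move=> p w v; apply: contains_upset.
(* The same truth lemma, with one more case for the tensor, where primeness of the worlds enters. *)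
apply: (resolved_top H B CG (X := [set t | clt_support V t phi])).
  elim: phi {val} => [p||a ha b hb|a ha b hb|a ha b hb|a ha b hb].
  - exact: (resolved_core _ _ _ _ (Cmu p)).
  - exact: (resolved_bot _ B).
  - exact: (resolved_meet H B CG ha hb).
  - exact: resolved_join ha hb.
  - exact: (resolved_imp H B CG split ha hb).
  - exact: (resolved_tensor H B CG HC dist tensorC ha hb).
exact: val.
Qed.

Theorem theorem4p22 (At : countType) :
  (forall phi : cl_formula At,
     (forall F : kripke_frame, cl_frame_valid F phi) <->
     (forall A : inq_structure, inquisitive_algebra A -> iq_core_valid A phi))
  /\
  (forall phi : clt_formula At,
     (forall F : kripke_frame, clt_frame_valid F phi) <->
     (forall A : dep_structure, dependence_algebra A -> well_connected A ->
        dp_core_valid A phi)).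
Proof.
split=> phi; split=> val.
- exact: inq_soundness.
- by move=> F V pV; apply: team_inq_valid pV _ (val _ (team_inq_algebra F)).
- by move=> A HA _; apply: dep_soundness.
- move=> F V pV; apply: team_dep_valid pV _ _.
  exact: val (team_dep_algebra F) (@team_dep_well_connected F).
Qed.
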